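(* For any $(a,b,c,\lambda,\delta),(\bar a,\bar b,\bar c,\bar\lambda,\bar\delta)\in(\mathbb F^\times)^4\times\mathbb F$ the following are equivalent: (i) $(a,b,c,\lambda,\delta)\simeq_{\pm,\mathfrak S_4}(\bar a,\bar b,\bar c,\bar\lambda,\bar\delta)$; (ii) there is a $\triangle_q$-module homomorphism $W_\lambda^\delta(a,b,c)\to W_{\bar\lambda}^{\bar\delta}(\bar a,\bar b,\bar c)$ sending $w_0$ to $\bar w_0$; (iii) there is a $\triangle_q$-module homomorphism $W_{\bar\lambda}^{\bar\delta}(\bar a,\bar b,\bar c)\to W_\lambda^\delta(a,b,c)$ sending $\bar w_0$ to $w_0$; (iv) there is a $\triangle_q$-module isomorphism $W_\lambda^\delta(a,b,c)\to W_{\bar\lambda}^{\bar\delta}(\bar a,\bar b,\bar c)$ sending $w_0$ to $\bar w_0$; (v) there is a $\triangle_q$-module isomorphism $W_{\bar\lambda}^{\bar\delta}(\bar a,\bar b,\bar c)\to W_\lambda^\delta(a,b,c)$ sending $\bar w_0$ to $w_0$.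
   Context: $\mathbb F$ is an algebraically closed field and $q\in\mathbb F^\times$ a root of unity of order $d\notin\{1,2,4\}$; $d'=d$ if $d$ odd, $d'=d/2$ if $d$ even; $\sqrt{x}$ is a fixed square root. $\triangle_q$ is the unital associative $\mathbb F$-algebra with generators $A,B,C$ subject to: each of $A+\frac{qBC-q^{-1}CB}{q^2-q^{-2}}$, $B+\frac{qCA-q^{-1}AC}{q^2-q^{-2}}$, $C+\frac{qAB-q^{-1}BA}{q^2-q^{-2}}$ is central; $\alpha,\beta,\gamma$ are these times $q+q^{-1}$. For $(a,b,c,\lambda)\in(\mathbb F^\times)^4$, $i\in\mathbb N$: $\theta_i=a\lambda^{-1}q^{2i}+a^{-1}\lambda q^{-2i}$, $\theta_i^*=b\lambda^{-1}q^{2i}+b^{-1}\lambda q^{-2i}$, $\varphi_i=a^{-1}b^{-1}\lambda q(q^i-q^{-i})(\lambda^{-1}q^{i-1}-\lambda q^{1-i})(q^{-i}-abc\lambda^{-1}q^{i-1})(q^{-i}-abc^{-1}\lambda^{-1}q^{i-1})$. $M_\lambda(a,b,c)$ has basis $\{m_i\}_{i\in\mathbb N}$, $(A-\theta_i)m_i=m_{i+1}$, $(B-\theta_i^* )m_i=\varphi_im_{i-1}$, $\alpha,\beta,\gamma$ acting as $(b+b^{-1})(c+c^{-1})+(a+a^{-1})(\lambda q+\lambda^{-1}q^{-1})$, $(c+c^{-1})(a+a^{-1})+(b+b^{-1})(\lambda q+\lambda^{-1}q^{-1})$, $(a+a^{-1})(b+b^{-1})+(c+c^{-1})(\lambda q+\lambda^{-1}q^{-1})$.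 $W_\lambda^\delta(a,b,c)$ is the quotient of $M_\lambda(a,b,c)$ by the span of $\{\delta m_i-m_{d'+i}\}_{i\in\mathbb N}$, $w_i$ the image of $m_i$; barred symbols for barred parameters. $\{\pm1\}$ acts on $(\mathbb F^\times)^4$ by $(-1)\cdot(a,b,c,\lambda)=(-a,-b,-c,-\lambda)$; with $[\cdot]$ the orbit, $\mathfrak S_4$ acts on the right by $[a,b,c,\lambda](1\,2)=[a,b,c^{-1},\lambda]$, $[a,b,c,\lambda](3\,4)=[a^{-1},b,c,\lambda]$, $[a,b,c,\lambda](2\,3)=[a/s,b/s,c/s,\lambda/s]$, $s=\sqrt{abc\lambda q}$. $(a,b,c,\lambda,\delta)\simeq_{\pm,\mathfrak S_4}(\bar a,\bar b,\bar c,\bar\lambda,\bar\delta)$ means the $\{\pm1\}$-orbits of $(a,b,c,\lambda)$ and $(\bar a,\bar b,\bar c,\bar\lambda)$ lie in the same $\mathfrak S_4$-orbit and $\delta+a^{d'}\lambda^{-d'}+a^{-d'}\lambda^{d'}=\bar\delta+\bar a^{d'}\bar\lambda^{-d'}+\bar a^{-d'}\bar\lambda^{d'}$. *)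

(* Defs.v *)
From HB Require Import structures.
From mathcomp Require Import all_boot all_order all_algebra.
Set Implicit Arguments. Unset Strict Implicit. Unset Printing Implicit Defensive.
Import Order.TTheory GRing.Theory.
Local Open Scope ring_scope.

Section Defs.
Variable F : closedFieldType.

Lemma sqrt_exists (x : F) : exists y : F, y ^+ 2 == x.
Proof.
have [y Hy] := @solve_monicpoly F 2 (nth 0 [:: x]) isT.
exists y; apply/eqP; rewrite Hy big_ord_recl big_ord1 /= expr0 mulr1 mul0r addr0 //.
Qed.

Definition sqrtF (x : F) : F := xchoose (sqrt_exists x).

Definition dprime (d : nat) : nat := if odd d then d else d./2.

Definition theta (a lam q : F) (i : nat) : F :=
  a * lam^-1 * q ^ (2 * i%:Z) + a^-1 * lam * q ^ (- (2 * i%:Z)).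

Definition thetas (b lam q : F) (i : nat) : F :=
  b * lam^-1 * q ^ (2 * i%:Z) + b^-1 * lam * q ^ (- (2 * i%:Z)).

Definition phi (a b c lam q : F) (i : nat) : F :=
  a^-1 * b^-1 * lam * q * (q ^ (i%:Z) - q ^ (- i%:Z))
  * (lam^-1 * q ^ (i%:Z - 1) - lam * q ^ (1 - i%:Z))
  * (q ^ (- i%:Z) - a * b * c * lam^-1 * q ^ (i%:Z - 1))
  * (q ^ (- i%:Z) - a * b * c^-1 * lam^-1 * q ^ (i%:Z - 1)).

(* the scalar by which gamma acts on M_lambda(a,b,c) *)
Definition gammaM (a b c lam q : F) : F :=
  (a + a^-1) * (b + b^-1) + (c + c^-1) * (lam * q + lam^-1 * q^-1).

(* ---- the module M_lambda(a,b,c): carrier {poly F}, m_i = 'X^i ---- *)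
Definition opA (a lam q : F) (p : {poly F}) : {poly F} :=
  \sum_(i < size p) p`_i *: (theta a lam q i *: 'X^i + 'X^(i.+1)).

(* (B - theta*_i) m_i = phi_i m_{i-1}  (phi_0 = 0, so m_{-1} never occurs) *)
Definition opB (a b c lam q : F) (p : {poly F}) : {poly F} :=
  \sum_(i < size p) p`_i *: (thetas b lam q i *: 'X^i + phi a b c lam q i *: 'X^(i.-1)).

(* C is determined by the action of the central element gamma:
   gamma = (q+q^-1) (C + (qAB - q^-1 BA)/(q^2-q^-2)) *)
Definition opC (a b c lam q : F) (p : {poly F}) : {poly F} :=
  (gammaM a b c lam q / (q + q^-1)) *: p
  - (q ^+ 2 - q ^- 2)^-1 *:
      (q *: opA a lam q (opB a b c lam q p) - q^-1 *: opB a b c lam q (opA a lam q p)).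

(* ---- W^delta_lambda(a,b,c) = M / N, N = span{ delta m_i - m_{d'+i} } ---- *)
Definition inN (n : nat) (delta : F) (p : {poly F}) : Prop :=
  exists r : {poly F},
    p = \sum_(i < size r) r`_i *: (delta *: 'X^i - 'X^(n + i)).

(* A Delta_q-module homomorphism g : W -> W' (W = W^delta_lam(a,b,c),
   W' = W^delta'_lam'(a',b',c'), both for the same q and n = d'),
   given through a linear lift f : M -> M' with f(N) <= N'
   (every linear map W -> W' arises this way).  It commutes with the
   generators A, B, C (hence with all of Delta_q), and w_0 |-> w'_0. *)
Definition Whom (q : F) (n : nat)
    (a b c lam delta a' b' c' lam' delta' : F) (f : {poly F} -> {poly F}) : Prop :=
  (forall (k : F) (u v : {poly F}), f (k *: u + v) = k *: f u + f v) /\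
  [/\ forall p, inN n delta p -> inN n delta' (f p),
      forall p, inN n delta' (f (opA a lam q p) - opA a' lam' q (f p)),
      forall p, inN n delta' (f (opB a b c lam q p) - opB a' b' c' lam' q (f p)),
      forall p, inN n delta' (f (opC a b c lam q p) - opC a' b' c' lam' q (f p))
    & inN n delta' (f 1 - 1)].

Definition Wiso (q : F) (n : nat)
    (a b c lam delta a' b' c' lam' delta' : F) (f : {poly F} -> {poly F}) : Prop :=
  [/\ Whom q n a b c lam delta a' b' c' lam' delta' f,
      forall p, inN n delta' (f p) -> inN n delta p
    & forall p', exists p, inN n delta' (f p - p')].

Definition quad := (F * F * F * F)%type.

Definition qneg (x : quad) : quad :=
  let: (a, b, c, l) := x in (- a, - b, - c, - l).
Definition s12 (x : quad) : quad :=
  let: (a, b, c, l) := x in (a, b, c^-1, l).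
Definition s34 (x : quad) : quad :=
  let: (a, b, c, l) := x in (a^-1, b, c, l).
Definition s23 (q : F) (x : quad) : quad :=
  let: (a, b, c, l) := x in
  let s := sqrtF (a * b * c * l * q) in (a / s, b / s, c / s, l / s).

Definition s4step (q : F) (x y : quad) : Prop :=
  y = qneg x \/ y = s12 x \/ y = s23 q x \/ y = s34 x.

(* y lies in the orbit of x under the group generated by {+-1} and S_4,
   i.e. [y] lies in the S_4-orbit of [x] *)
Inductive s4orbit (q : F) (x : quad) : quad -> Prop :=
| s4orbit_refl : s4orbit q x x
| s4orbit_step y z : s4orbit q x y -> s4step q y z -> s4orbit q x z.

Definition equivS4 (q : F) (n : nat)
    (a b c lam delta a' b' c' lam' delta' : F) : Prop :=
  s4orbit q (a, b, c, lam) (a', b', c', lam') /\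
  delta + a ^+ n * lam ^- n + a ^- n * lam ^+ n
  = delta' + a' ^+ n * lam' ^- n + a' ^- n * lam' ^+ n.

End Defs.

(* Main.v *)
(** Sending [m_i] to the Newton polynomial [\prod_(j < i) ('X - theta_j)] identifies [M] with
    [F[X]], so that [A] becomes multiplication by [X] and the submodule defining [W] becomes the
    ideal generated by [P = T - tau]; here [T (y + y^-1) = y^n + y^-n], [n = d'], and
    [tau = delta + (a / lam)^n + (a / lam)^-n].  A homomorphism fixing the class of [1] is then
    the identity modulo [P], so it exists iff the two [tau] agree and the two operators [B] agree
    modulo [P].  The relation for [B A^2] determines [B] from [B 1], [B X], [beta] and [gamma],
    which have degree at most [1 < n] and hence are equal as soon as they are congruent.  So
    everything reduces to [tau] and to the four numbers [b / lam], [kappa], [beta], [gamma],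
    where [(q - q^-1) kappa] is the constant term of [B X].  Up to an invertible change of
    unknowns the latter three are the elementary symmetric functions of four numbers of product
    [1], on which [S_4] acts by permutation. *)

Require Import Defs.
From HB Require Import structures.
From mathcomp Require Import all_boot all_order all_algebra ring.
Import GRing.Theory.
Local Open Scope ring_scope.

(** * Linear maps on polynomials and the Newton model of M *)

Section PolynomialMaps.
Variable F : closedFieldType.
Implicit Types (p u v : {poly F}) (e : nat -> {poly F}).

Lemma poly_span_ind (P : {poly F} -> Prop) :
  (forall i, P 'X^i) -> (forall k u v, P u -> P v -> P (k *: u + v)) ->
  forall p, P p.
Proof.
move=> PX PD p.
have P0 : P 0 by rewrite -(addNr ('X^0 : {poly F})) -scaleN1r; apply: PD.
rewrite -[p]coefK poly_def; elim/big_rec: _ => // i u _ Pu; exact: PD.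
Qed.

(** [opA] and [opB] are convertible to instances of this map, so they inherit its linearity and its
    values on monomials. *)
Definition linext e p : {poly F} := \sum_(i < size p) p`_i *: e i.

Lemma linext_widen e p n : (size p <= n)%N ->
  linext e p = \sum_(i < n) p`_i *: e i.
Proof.
move=> le_pn; rewrite /linext (big_ord_widen _ (fun i => p`_i *: e i) le_pn) /=.
rewrite big_mkcond; apply: eq_bigr => i _; case: ltnP => // /leq_sizeP -> //.
by rewrite scale0r.
Qed.

Lemma linext_linear e : linear (linext e).
Proof.
move=> k u v; pose n := maxn (size (k *: u + v)) (maxn (size u) (size v)).
rewrite !(@linext_widen e _ n) ?leq_max ?leqnn ?orbT //.
rewrite scaler_sumr -big_split; apply: eq_bigr => i _.
by rewrite coefD coefZ scalerDl scalerA.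
Qed.

HB.instance Definition _ e :=
  GRing.isLinear.Build F {poly F} {poly F} _ (linext e) (linext_linear e).

Lemma linextXn e i : linext e 'X^i = e i.
Proof.
rewrite (@linext_widen e _ i.+1) ?size_polyXn // big_ord_recr /= big1 ?add0r.
  by rewrite coefXn eqxx scale1r.
by move=> j _; rewrite coefXn ltn_eqF ?scale0r.
Qed.

HB.instance Definition _ a lam q := GRing.Linear.copy (@opA F a lam q)
  (linext (fun i => theta a lam q i *: 'X^i + 'X^(i.+1))).

HB.instance Definition _ a b c lam q := GRing.Linear.copy (@opB F a b c lam q)
  (linext (fun i => thetas b lam q i *: 'X^i + phi a b c lam q i *: 'X^(i.-1))).

Lemma opAXn (a lam q : F) i :
  opA a lam q 'X^i = theta a lam q i *: 'X^i + 'X^(i.+1).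
Proof. exact: linextXn (fun i => theta a lam q i *: 'X^i + 'X^(i.+1)) i. Qed.

Lemma opBXn (a b c lam q : F) i :
  opB a b c lam q 'X^i = thetas b lam q i *: 'X^i + phi a b c lam q i *: 'X^(i.-1).
Proof. 
exact: linextXn (fun i => thetas b lam q i *: 'X^i + phi a b c lam q i *: 'X^(i.-1)) i.
Qed.

Definition newton (a lam q : F) i : {poly F} :=
  \prod_(j < i) ('X - (theta a lam q j)%:P).

Lemma newtonS (a lam q : F) i :
  newton a lam q i.+1 = newton a lam q i * ('X - (theta a lam q i)%:P).
Proof. by rewrite /newton big_ord_recr. Qed.

(** Inverse isomorphisms between M and F[X]: [toX] sends m_i to a Newton polynomial, [ofX] evaluates
    a polynomial at the operator A and applies the result to m_0. *)
Definition toX (a lam q : F) := linext (newton a lam q).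
Definition ofX (a lam q : F) := linext (fun i => iter i (opA a lam q) 1).

HB.instance Definition _ a lam q :=
  GRing.Linear.copy (toX a lam q) (linext (newton a lam q)).
HB.instance Definition _ a lam q :=
  GRing.Linear.copy (ofX a lam q) (linext (fun i => iter i (opA a lam q) 1)).

Lemma toXXn (a lam q : F) i : toX a lam q 'X^i = newton a lam q i.
Proof. exact: linextXn. Qed.

Lemma ofXXn (a lam q : F) i : ofX a lam q 'X^i = iter i (opA a lam q) 1.
Proof. exact: linextXn. Qed.

Lemma toX1 (a lam q : F) : toX a lam q 1 = 1.
Proof. by rewrite -(expr0 'X) toXXn /newton big_ord0. Qed.

Lemma ofX1 (a lam q : F) : ofX a lam q 1 = 1.
Proof. by rewrite -(expr0 'X) ofXXn. Qed.

Lemma toX_opA (a lam q : F) p :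
  toX a lam q (opA a lam q p) = 'X * toX a lam q p.
Proof.
elim/poly_span_ind: p => [i|k u v IHu IHv]; last first.
  by rewrite !linearP /= IHu IHv mulrDr -scalerAr.
rewrite opAXn linearD linearZ /= !toXXn newtonS -mul_polyC; ring.
Qed.

Lemma ofX_mulX (a lam q : F) p :
  ofX a lam q ('X * p) = opA a lam q (ofX a lam q p).
Proof.
elim/poly_span_ind: p => [i|k u v IHu IHv]; last first.
  by rewrite mulrDr -scalerAr !linearP /= IHu IHv.
by rewrite -exprS !ofXXn.
Qed.

Lemma ofXK (a lam q : F) : cancel (ofX a lam q) (toX a lam q).
Proof.
elim/poly_span_ind => [i|k u v IHu IHv]; last by rewrite !linearP /= IHu IHv.
elim: i => [|i IHi]; first by rewrite expr0 ofX1 toX1.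
by rewrite exprS ofX_mulX toX_opA IHi.
Qed.

Lemma toXK (a lam q : F) : cancel (toX a lam q) (ofX a lam q).
Proof.
elim/poly_span_ind => [i|k u v IHu IHv]; last by rewrite !linearP /= IHu IHv.
elim: i => [|i IHi]; first by rewrite expr0 toX1 ofX1.
rewrite toXXn newtonS mulrC mulrBl linearB /= ofX_mulX mul_polyC linearZ /=.
by rewrite -toXXn IHi opAXn addrC addKr.
Qed.

End PolynomialMaps.

(** * The relation between A and B on M *)

Section Relation.
Variable F : closedFieldType.

(* the scalar by which [beta] acts on [M_lambda(a,b,c)] *)
Definition betaM (a b c lam q : F) : F :=
  (c + c^-1) * (a + a^-1) + (b + b^-1) * (lam * q + lam^-1 * q^-1).

Definition kappaM (a b c lam q : F) : F :=
  (c + c^-1) * (lam - lam^-1) - (a + a^-1) * (b * q - b^-1 * q^-1).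

Variables (q a b c lam : F).
Hypotheses (q0 : q != 0) (a0 : a != 0) (b0 : b != 0) (c0 : c != 0) (l0 : lam != 0).

(** Writing [theta], [thetas] and [phi] through [q ^+ i] turns identities between them into rational
    identities that [field] can decide. *)
Lemma thetaE i :
  theta a lam q i = a / lam * (q ^+ i) ^+ 2 + lam / a / (q ^+ i) ^+ 2.
Proof.
have E2 : 2 * i%:Z = (i * 2)%N by rewrite PoszM mulrC.
by rewrite /theta E2 -exprnN -exprnP exprM [a^-1 * _]mulrC.
Qed.

Lemma thetasE i :
  thetas b lam q i = b / lam * (q ^+ i) ^+ 2 + lam / b / (q ^+ i) ^+ 2.
Proof.
have E2 : 2 * i%:Z = (i * 2)%N by rewrite PoszM mulrC.
by rewrite /thetas E2 -exprnN -exprnP exprM [b^-1 * _]mulrC.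
Qed.

Lemma phiE i (u := q ^+ i) :
  phi a b c lam q i = a^-1 * b^-1 * lam * q * (u - u^-1)
  * (lam^-1 * (u / q) - lam * (q / u))
  * (u^-1 - a * b * c * lam^-1 * (u / q))
  * (u^-1 - a * b * c^-1 * lam^-1 * (u / q)).
Proof.
have Eu : q ^ (i%:Z - 1) = u / q by rewrite expfzDr // -exprnP exprN1.
have Eu' : q ^ (1 - i%:Z) = q / u by rewrite expfzDr // expr1z -exprnN.
by rewrite /phi Eu Eu' -exprnN -exprnP.
Qed.

Lemma phi0 : phi a b c lam q 0 = 0.
Proof. by rewrite phiE expr0 invr1 subrr mulr0 !mul0r. Qed.

(** This is the defining relation for beta with C eliminated by the one for gamma. It is checked on
    each basis vector m_i. *)
Lemma opB_relation p (h := q ^+ 2 - q ^- 2) (A := opA a lam q) (B := opB a b c lam q) :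
  B (A (A p)) = (q ^+ 2 + q ^- 2) *: A (B (A p)) - A (A (B p)) - h ^+ 2 *: B p
    - ((q - q^-1) ^+ 2 * gammaM a b c lam q) *: A p
    + ((q - q^-1) * h * betaM a b c lam q) *: p.
Proof.
elim/poly_span_ind: p => [i|k u v IHu IHv]; last first.
  by rewrite /A /B !linearP /= -/A -/B IHu IHv -!mul_polyC !polyCM; ring.
pose u := q ^+ i.
have u0 : u != 0 by rewrite expf_neq0.
pose t (w : F) := a / lam * w ^+ 2 + lam / a / w ^+ 2.
pose s (w : F) := b / lam * w ^+ 2 + lam / b / w ^+ 2.
pose f (w : F) := a^-1 * b^-1 * lam * q * (w - w^-1)
  * (lam^-1 * (w / q) - lam * (q / w))
  * (w^-1 - a * b * c * lam^-1 * (w / q))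
  * (w^-1 - a * b * c^-1 * lam^-1 * (w / q)).
pose x0 : {poly F} := 'X^(i.-1).
have tE k : theta a lam q (k + i) = t (q ^+ k * u) by rewrite thetaE exprD.
have sE k : thetas b lam q (k + i) = s (q ^+ k * u) by rewrite thetasE exprD.
have fE k : phi a b c lam q (k + i) = f (q ^+ k * u) by rewrite phiE exprD.
have A1 : A 'X^i = t u *: 'X^i + 'X^(i.+1) by rewrite /A opAXn (tE 0%N) mul1r.
have A2 : A 'X^(i.+1) = t (q * u) *: 'X^(i.+1) + 'X^(i.+2).
  by rewrite /A opAXn (tE 1%N).
(* For [i = 0] the truncated [i.-1] makes [x0] equal to 1; this is harmless because [f u] is then
   0. *)
have A0 : A (f u *: x0) = (f u * t (u / q)) *: x0 + f u *: 'X^i.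
  rewrite /A linearZ /= /x0 opAXn scalerDr scalerA /u.
  case: i {tE sE fE A1 A2 x0 u0} @u => [|i] u; last first.
    by rewrite thetaE exprS [q * _]mulrC mulfK.
  by rewrite expr0 /f invr1 subrr mulr0 !mul0r !scale0r.
have B1 : B 'X^i = s u *: 'X^i + f u *: x0.
  by rewrite /B opBXn (sE 0%N) (fE 0%N) mul1r.
have B2 : B 'X^(i.+1) = s (q * u) *: 'X^(i.+1) + f (q * u) *: 'X^i.
  by rewrite /B opBXn (sE 1%N) (fE 1%N).
have B3 : B 'X^(i.+2) = s (q ^+ 2 * u) *: 'X^(i.+2) + f (q ^+ 2 * u) *: 'X^(i.+1).
  by rewrite /B opBXn (sE 2%N) (fE 2%N).
have AP k v w : A (k *: v + w) = k *: A v + A w by rewrite /A linearP.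
have BP k v w : B (k *: v + w) = k *: B v + B w by rewrite /B linearP.
have AD v w : A (v + w) = A v + A w by rewrite /A linearD.
have AZ k v : A (k *: v) = k *: A v by rewrite /A linearZ.
clear tE sE fE.
pose K := q ^+ 2 + q ^- 2; pose g := (q - q^-1) ^+ 2 * gammaM a b c lam q.
pose e := (q - q^-1) * h * betaM a b c lam q.
(* [E3], [E2], [E1], [E0] compare the coefficients of m_(i+2), m_(i+1), m_i and m_(i-1). The last
   three are then solved for a term to be rewritten, which leaves an identity for [ring]. *)
have E3 : s (q ^+ 2 * u) = K * s (q * u) - s u.
  by rewrite /s /K; field; rewrite ?q0 ?b0 ?l0 ?u0.
have E2 : (t u + t (q * u)) * s (q * u) + f (q ^+ 2 * u)
    = K * (t u * s u + t (q * u) * s (q * u) + f (q * u))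
      - (t u + t (q * u)) * s u - f u - g.
  by rewrite /s /t /f /K /g /gammaM; field; rewrite ?q0 ?a0 ?b0 ?c0 ?l0 ?u0.
have E1 : t u ^+ 2 * s u + (t u + t (q * u)) * f (q * u)
   = K * (t u * (t u * s u + f (q * u)) + t u * f u) - (t u ^+ 2 * s u + (t u + t (u / q)) * f u)
     - h ^+ 2 * s u - g * t u + e.
  by rewrite /s /t /f /K /g /e /h /gammaM /betaM; field; rewrite ?q0 ?a0 ?b0 ?c0 ?l0 ?u0.
have E0 : t u ^+ 2 * f u = K * (t u * f u * t (u / q)) - f u * t (u / q) ^+ 2 - h ^+ 2 * f u.
  by rewrite /s /t /f /K /h; field; rewrite ?q0 ?a0 ?b0 ?c0 ?l0 ?u0.
rewrite -/K -/g -/e.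
have {}E2 : f (q ^+ 2 * u) = K * (t u * s u + t (q * u) * s (q * u) + f (q * u))
    - (t u + t (q * u)) * s u - f u - g - (t u + t (q * u)) * s (q * u).
  by rewrite -E2 [RHS]addrC addKr.
have {}E1 : e = t u ^+ 2 * s u + (t u + t (q * u)) * f (q * u)
   - K * (t u * (t u * s u + f (q * u)) + t u * f u)
   + (t u ^+ 2 * s u + (t u + t (u / q)) * f u) + h ^+ 2 * s u + g * t u.
  by rewrite E1; ring.
have {}E0 : h ^+ 2 * f u
    = K * (t u * f u * t (u / q)) - f u * t (u / q) ^+ 2 - t u ^+ 2 * f u.
  by rewrite E0; ring.
have AB1 : A (B 'X^i) = s u *: (t u *: 'X^i + 'X^(i.+1))
    + ((f u * t (u / q)) *: x0 + f u *: 'X^i) by rewrite B1 AP A1 A0.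
have A00 : A ((f u * t (u / q)) *: x0)
    = t (u / q) *: ((f u * t (u / q)) *: x0 + f u *: 'X^i).
  by rewrite [X in A (X *: _)]mulrC -[X in A X]scalerA AZ A0.
have AAB : A (A (B 'X^i)) = s u *: (t u *: (t u *: 'X^i + 'X^(i.+1))
      + (t (q * u) *: 'X^(i.+1) + 'X^(i.+2)))
    + (t (u / q) *: ((f u * t (u / q)) *: x0 + f u *: 'X^i)
      + f u *: (t u *: 'X^i + 'X^(i.+1))).
  by rewrite AB1 AP AP A1 A2 AD A00 AZ A1.
have ABA : A (B (A 'X^i)) = t u *: A (B 'X^i)
    + (s (q * u) *: (t (q * u) *: 'X^(i.+1) + 'X^(i.+2))
      + f (q * u) *: (t u *: 'X^i + 'X^(i.+1))).
  by rewrite A1 BP AP B2 AP AZ A2 A1.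
have BAA : B (A (A 'X^i)) = t u *: (t u *: (s u *: 'X^i + f u *: x0)
      + (s (q * u) *: 'X^(i.+1) + f (q * u) *: 'X^i))
    + (t (q * u) *: (s (q * u) *: 'X^(i.+1) + f (q * u) *: 'X^i)
      + (s (q ^+ 2 * u) *: 'X^(i.+2) + f (q ^+ 2 * u) *: 'X^(i.+1))).
  by rewrite A1 AP A1 A2 !BP B1 B2 B3.
rewrite AAB ABA AB1 BAA A1 B1 E1 E2 E3 [h ^+ 2 *: (_ + _)]scalerDr.
rewrite [h ^+ 2 *: (f u *: _)]scalerA E0.
move: (s u) (s _) (t u) (t _) (t _) (f u) (f _) (K) (g) (h ^+ 2) => s0 s1 t0 t1 tm f0 f1 K' g' h'.
move: (x0) 'X^i 'X^(i.+1) 'X^(i.+2) => y0 y1 y2 y3.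
by rewrite -!mul_polyC; ring.
Qed.
End Relation.

(** * Periodicity and the ideal defining W *)

Section Quotient.
Variable F : closedFieldType.
Variables (q : F) (n : nat).
Hypotheses (q0 : q != 0) (prim_q2 : n.-primitive_root (q ^+ 2)).

Lemma prim_root_inv (z : F) : n.-primitive_root z -> n.-primitive_root z^-1.
Proof.
move=> prim_z; have n_gt0 := prim_order_gt0 prim_z.
have z0 : z != 0 by rewrite (prim_root_eq0 prim_z) -lt0n.
suff -> : z^-1 = z ^+ n.-1.
  by rewrite prim_root_exp_coprime // -{2}(prednK n_gt0) coprimenS.
apply: (mulfI z0).
by rewrite divff // -exprS prednK // prim_expr_order.
Qed.

(** Substitute [y / x] into the factorization of X^n - 1 and scale by [x ^+ n]. *)
Lemma prod_subr_prim_root (z x y : F) : n.-primitive_root z -> x != 0 ->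
  \prod_(j < n) (y - x * z ^+ j) = y ^+ n - x ^+ n.
Proof.
move=> prim_z x0; have /(congr1 (fun p => p.[y / x])) := factor_Xn_sub_1 prim_z.
rewrite horner_prod !hornerE big_mkord => Ez.
have -> : y ^+ n - x ^+ n = x ^+ n * ((y / x) ^+ n - 1).
  by rewrite mulrBr mulr1 -exprMn mulrC divfK.
rewrite -Ez -[X in x ^+ X]card_ord -prodr_const -big_split /=.
by apply: eq_bigr => j _; rewrite !hornerE mulrBr [x * (y / x)]mulrC divfK.
Qed.

Section Periodicity.
Variables (a b c lam : F).
Hypotheses (a0 : a != 0) (b0 : b != 0) (c0 : c != 0) (l0 : lam != 0).

(** With x = a / lam, each factor y + y^-1 - x q^(2j) - x^-1 q^(-2j) splits as (y - x q^(2j)) (y -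
    x^-1 q^(-2j)) / y, and each of the two products runs over all powers of a primitive root. *)
Lemma newton_horner y : y != 0 -> (newton F a lam q n).[y + y^-1] =
  y ^+ n + y ^- n - (a ^+ n * lam ^- n + a ^- n * lam ^+ n).
Proof.
move=> y0; pose x := a / lam; have x0 : x != 0 by rewrite mulf_neq0 ?invr_eq0.
have -> : a ^+ n * lam ^- n = x ^+ n by rewrite expr_div_n.
have -> : a ^- n * lam ^+ n = x ^- n by rewrite expr_div_n invf_div mulrC.
rewrite horner_prod.
transitivity (\prod_(j < n) ((y - x * (q ^+ 2) ^+ j) * (y - x^-1 * (q ^+ 2)^-1 ^+ j)) / y ^+ n).
  rewrite -[X in y ^+ X]card_ord -prodr_const -prodf_div /=.
  apply: eq_bigr => j _; rewrite !hornerE thetaE // -!exprM mulnC exprM exprVn.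
  by rewrite /x; field; rewrite ?expf_neq0 ?y0 ?a0 ?l0.
rewrite big_split /= !prod_subr_prim_root ?invr_eq0 //; last exact: prim_root_inv.
rewrite exprVn; field; by rewrite !expf_neq0.
Qed.

Lemma expq2Dn i : (q ^+ (n + i)) ^+ 2 = (q ^+ i) ^+ 2.
Proof. by rewrite -exprM mulnC exprM exprD prim_expr_order // mul1r -!exprM mulnC. Qed.

Lemma thetaDn i : theta a lam q (n + i) = theta a lam q i.
Proof. by rewrite !thetaE // expq2Dn. Qed.

Lemma thetasDn i : thetas b lam q (n + i) = thetas b lam q i.
Proof. by rewrite !thetasE // expq2Dn. Qed.

(** From q^(2n) = 1 follows q^n = 1 or q^n = -1, and [phi] is even in [q ^+ i], being a constant
    times four odd factors. *)
Lemma phiDn i : phi a b c lam q (n + i) = phi a b c lam q i.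
Proof.
have : (q ^+ n) ^+ 2 == 1 by rewrite -exprM mulnC exprM prim_expr_order.
rewrite sqrf_eq1 !phiE // exprD => /orP[]/eqP->; first by rewrite mul1r.
have : q ^+ i != 0 by rewrite expf_neq0.
by move: (q ^+ i) => u u0; rewrite mulN1r invrN; field; rewrite ?q0 ?a0 ?b0 ?c0 ?l0 ?u0.
Qed.

Lemma newtonDn i : newton F a lam q (n + i) = newton F a lam q n * newton F a lam q i.
Proof.
by rewrite /newton big_split_ord /=; congr (_ * _); apply: eq_bigr => j _; rewrite thetaDn.
Qed.

(** By [newtonDn] a generator delta m_i - m_(n+i) goes to -(N_n - delta) N_i, where the N_i are the
    Newton polynomials, and these span F[X]. *)
Lemma inN_toX delta p : inN n delta p <->
  exists s, toX F a lam q p = (newton F a lam q n - delta%:P) * s.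
Proof.
have toXE r : toX F a lam q (linext F (fun i => delta *: 'X^i - 'X^(n + i)) r)
    = (newton F a lam q n - delta%:P) * - toX F a lam q r.
  elim/poly_span_ind: r => [i|k u v IHu IHv]; last first.
    by rewrite !linearP /= IHu IHv -!mul_polyC; ring.
  by rewrite linextXn linearB linearZ /= !toXXn newtonDn -mul_polyC; ring.
split=> [[r ->]|[s Es]]; first by exists (- toX F a lam q r); exact: toXE.
exists (- ofX F a lam q s); apply: (can_inj (toXK F a lam q)); rewrite [RHS]toXE Es.
by rewrite linearN /= opprK ofXK.
Qed.

Lemma inN_opB delta p : inN n delta p -> inN n delta (opB a b c lam q p).
Proof.
(* For the generator with i = 0, this removes the term in m_(n-1) from B m_n. *)
have phin : phi a b c lam q n = 0 by rewrite -[n]addn0 phiDn phi0.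
pose e i : {poly F} := delta *: 'X^i - 'X^(n + i).
case=> r ->; exists (opB a b c lam q r); rewrite -/(linext F e r) -/(linext F e _).
elim/poly_span_ind: r => [i|k u v IHu IHv]; last first.
  by rewrite !linearP /= IHu IHv.
rewrite opBXn linearD !linearZ /= !linextXn /e linearB linearZ /= !opBXn.
rewrite thetasDn phiDn; case: i => [|i].
  by rewrite phi0 // !scale0r !addr0 scalerBr !scalerA mulrC.
by rewrite addnS /= !scalerBr !scalerDr !scalerA -!mul_polyC !polyCM; ring.
Qed.

End Periodicity.

(** At y + y^-1 both sides take the value y^n + y^-n, and over an algebraically closed field every
    element has the form y + y^-1. *)
Lemma newton_shift (a lam a' lam' : F) : a != 0 -> lam != 0 -> a' != 0 -> lam' != 0 ->
  newton F a lam q n + (a ^+ n * lam ^- n + a ^- n * lam ^+ n)%:P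
  = newton F a' lam' q n + (a' ^+ n * lam' ^- n + a' ^- n * lam' ^+ n)%:P.
Proof.
move=> a0 l0 a'0 l'0; apply/eqP; rewrite -subr_eq0; apply/eqP; set r := _ - _.
have r0 t : r.[t] = 0.
  have [y] := @solve_monicpoly F 2 (nth 0 [:: -1; t]) isT.
  rewrite big_ord_recl big_ord1 /= expr0 mulr1 expr1 => Ey.
  have y0 : y != 0.
    by apply: contra_eq_neq Ey => ->; rewrite expr0n /= mulr0 addr0 eq_sym oppr_eq0 oner_eq0.
  have -> : t = y + y^-1.
    apply: (mulIf y0); rewrite mulrDl mulVf // -expr2 Ey; ring.
  by rewrite /r hornerD hornerN !hornerD !hornerC !newton_horner // !subrK subrr.
clearbody r.
(* A root of [r + 1] would contradict that [r] vanishes everywhere, so [r + 1] is a nonzero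
   constant. *)
have [/closed_rootP[x]|] := boolP (size (r + 1) != 1%N).
  by rewrite rootE !hornerE r0 add0r oner_eq0.
move/negbNE=> /size_poly1P[k _ Ek].
have Er : r = (k - 1)%:P by rewrite polyCB -Ek addrK.
by move: (r0 0); rewrite Er hornerC => ->.
Qed.
End Quotient.

(** * The operators B and C on F[X] *)

Section Transport.
Variable F : closedFieldType.
Implicit Types (a b c lam q : F) (p : {poly F}).

Definition opBX a b c lam q p := toX F a lam q (opB a b c lam q (ofX F a lam q p)).

Definition opCX a b c lam q p : {poly F} :=
  (gammaM a b c lam q / (q + q^-1)) *: p
  - (q ^+ 2 - q ^- 2)^-1 *:
      (q *: ('X * opBX a b c lam q p) - q^-1 *: opBX a b c lam q ('X * p)).

Lemma opBX_linear a b c lam q : linear (opBX a b c lam q).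
Proof. by move=> k u v; rewrite /opBX !linearP. Qed.

HB.instance Definition _ a b c lam q :=
  GRing.isLinear.Build F {poly F} {poly F} _ (opBX a b c lam q) (opBX_linear a b c lam q).

Lemma opCX_linear a b c lam q : linear (opCX a b c lam q).
Proof.
move=> k u v; rewrite /opCX mulrDr -scalerAr !linearP /= -!mul_polyC.
by rewrite !polyCM; ring.
Qed.

HB.instance Definition _ a b c lam q :=
  GRing.isLinear.Build F {poly F} {poly F} _ (opCX a b c lam q) (opCX_linear a b c lam q).

Lemma toXD a lam q u v : toX F a lam q (u + v) = toX F a lam q u + toX F a lam q v.
Proof. exact: linearD. Qed.

Lemma toXN a lam q u : toX F a lam q (- u) = - toX F a lam q u.
Proof. exact: linearN. Qed.

Lemma toXZ a lam q k u : toX F a lam q (k *: u) = k *: toX F a lam q u.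
Proof. exact: linearZ. Qed.

Lemma toX_opB a b c lam q p :
  toX F a lam q (opB a b c lam q p) = opBX a b c lam q (toX F a lam q p).
Proof. by rewrite /opBX toXK. Qed.

Lemma toX_opC a b c lam q p :
  toX F a lam q (opC a b c lam q p) = opCX a b c lam q (toX F a lam q p).
Proof.
by rewrite /opC /opCX !(toXD, toXN, toXZ) toX_opA !toX_opB toX_opA.
Qed.

Section InitialValues.
Variables (q a b c lam : F).
Hypotheses (q0 : q != 0) (a0 : a != 0) (b0 : b != 0) (c0 : c != 0) (l0 : lam != 0).
Let y := b / lam.

Lemma opBX1 : opBX a b c lam q 1 = (y + y^-1)%:P.
Proof.
rewrite /opBX ofX1 -(expr0 'X) opBXn phi0 // scale0r addr0 linearZ /= expr0 toX1.
by rewrite thetasE // expr0 expr1n divr1 mulr1 -mul_polyC mulr1 /y invf_div.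
Qed.

(** X corresponds to A m_0 = theta_0 m_0 + m_1; applying B gives theta_0 thetas_0 m_0 + thetas_1 m_1
    + phi_1 m_0, and m_1 corresponds to X - theta_0. *)
Lemma opBX_X : opBX a b c lam q 'X =
  (y * q ^+ 2 + (y * q ^+ 2)^-1) *: 'X + ((q - q^-1) * kappaM F a b c lam q)%:P.
Proof.
have toXX : toX F a lam q 'X = 'X - (theta a lam q 0)%:P.
  by rewrite -['X]expr1 toXXn /newton big_ord1.
rewrite /opBX -[X in ofX _ _ _ _ X]mulr1 ofX_mulX ofX1 -(expr0 'X) opAXn.
rewrite linearD linearZ /= !opBXn phi0 // scale0r addr0 expr1 expr0.
rewrite !(linearD, linearZ) /= toXX !linearZ /= !toX1.
rewrite !(thetaE, thetasE, phiE) // expr0 expr1 -!mul_polyC !mulr1.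
have -> : (q - q^-1) * kappaM F a b c lam q = (a / lam * 1 ^+ 2 + lam / a / 1 ^+ 2) *
  (b / lam * 1 ^+ 2 + lam / b / 1 ^+ 2 - (b / lam * q ^+ 2 + lam / b / q ^+ 2)) +
  a^-1 * b^-1 * lam * q * (q - q^-1)
  * (lam^-1 * (q / q) - lam * (q / q))
  * (q^-1 - a * b * c * lam^-1 * (q / q))
  * (q^-1 - a * b * c^-1 * lam^-1 * (q / q)).
  by rewrite /kappaM; field; rewrite q0 a0 b0 c0 l0 oner_eq0.
have -> : y * q ^+ 2 + (y * q ^+ 2)^-1 = b / lam * q ^+ 2 + lam / b / q ^+ 2.
  by rewrite /y; field; rewrite q0 b0 l0.
rewrite !(polyCD, polyCM, polyCN); ring.
Qed.

Lemma opBX_mulXX p (h := q ^+ 2 - q ^- 2) :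
  opBX a b c lam q ('X * ('X * p)) =
    (q ^+ 2 + q ^- 2) *: ('X * opBX a b c lam q ('X * p))
    - 'X * ('X * opBX a b c lam q p) - h ^+ 2 *: opBX a b c lam q p
    - ((q - q^-1) ^+ 2 * gammaM a b c lam q) *: ('X * p)
    + ((q - q^-1) * h * betaM F a b c lam q) *: p.
Proof.
have := congr1 (toX F a lam q) (opB_relation F q a b c lam q0 a0 b0 c0 l0 (ofX F a lam q p)).
by rewrite !(toXD, toXN, toXZ) !(toX_opA, toX_opB) !ofXK.
Qed.

(** For fixed q these numbers determine [opBX], and on nonzero quadruples they separate the
    orbits. *)
Definition invariants (a b c lam q : F) : F * F * F * F :=
  (b / lam, kappaM F a b c lam q, gammaM a b c lam q, betaM F a b c lam q).

End InitialValues.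

Section Comparison.
Variables (q a b c lam a' b' c' lam' : F).
Hypotheses (q0 : q != 0) (a0 : a != 0) (b0 : b != 0) (c0 : c != 0) (l0 : lam != 0).
Hypotheses (a'0 : a' != 0) (b'0 : b' != 0) (c'0 : c' != 0) (l'0 : lam' != 0).

(** [opBX_mulXX] is a two-term recursion for the images of the powers of X; its coefficients and
    initial values depend only on q and the invariants. *)
Lemma opBX_invariants : invariants a b c lam q = invariants a' b' c' lam' q ->
  opBX a b c lam q =1 opBX a' b' c' lam' q.
Proof.
case=> Ey Ek Eg Eb; elim/poly_span_ind => [i|k u v IHu IHv]; last by rewrite !linearP /= IHu IHv.
suff: opBX a b c lam q 'X^i = opBX a' b' c' lam' q 'X^i /\
      opBX a b c lam q 'X^(i.+1) = opBX a' b' c' lam' q 'X^(i.+1) by case.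
elim: i => [|i [IHi IHi1]].
  by rewrite expr0 expr1 !opBX1 // !opBX_X // Ey Ek.
by split=> //; rewrite exprS exprS !opBX_mulXX // -exprS IHi IHi1 Eg Eb.
Qed.

End Comparison.
End Transport.

(** * Homomorphisms between the modules W *)

Section Morphisms.
Variable F : closedFieldType.
Variables (q : F) (n : nat) (a b c lam delta a' b' c' lam' delta' : F).
Hypotheses (q0 : q != 0) (q4 : q ^+ 4 != 1) (n_gt1 : (1 < n)%N).
Hypothesis prim_q2 : n.-primitive_root (q ^+ 2).
Hypotheses (a0 : a != 0) (b0 : b != 0) (c0 : c != 0) (l0 : lam != 0).
Hypotheses (a'0 : a' != 0) (b'0 : b' != 0) (c'0 : c' != 0) (l'0 : lam' != 0).

Let tau (a lam delta : F) := delta + a ^+ n * lam ^- n + a ^- n * lam ^+ n.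
Let P := newton F a lam q n - delta%:P.
Let P' := newton F a' lam' q n - delta'%:P.

Lemma modulus_eq : P = P' + (tau a' lam' delta' - tau a lam delta)%:P.
Proof.
have := newton_shift F q n q0 prim_q2 a lam a' lam' a0 l0 a'0 l'0.
move/(canRL (addrK _)); rewrite /P /P' /tau => ->.
by rewrite !(polyCB, polyCD); ring.
Qed.

Lemma inN0 m e : inN m e (0 : {poly F}).
Proof. by exists 0; rewrite size_poly0 big_ord0. Qed.

Lemma Wiso_of_invariants :
  invariants F a b c lam q = invariants F a' b' c' lam' q ->
  tau a lam delta = tau a' lam' delta' ->
  exists f, Wiso q n a b c lam delta a' b' c' lam' delta' f.
Proof.
move=> Einv Etau; have EP : P = P' by rewrite modulus_eq Etau subrr addr0.
(* In terms of F[X] this map is the identity. *)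
pose f p := ofX F a' lam' q (toX F a lam q p).
have EB := opBX_invariants F q a b c lam a' b' c' lam' q0 a0 b0 c0 l0 a'0 b'0 c'0 l'0 Einv.
have toXf p : toX F a' lam' q (f p) = toX F a lam q p by rewrite /f ofXK.
have EN p : inN n delta p <-> inN n delta' (f p).
  rewrite (inN_toX F q n prim_q2 a lam) (inN_toX F q n prim_q2 a' lam').
  by rewrite toXf -/P -/P' EP.
have inj := can_inj (toXK F a' lam' q).
have N0 u v : u = v -> inN n delta' (u - v) by move->; rewrite subrr; exact: inN0.
exists f; split; last 2 first.
- by move=> p /EN.
- move=> p'; exists (ofX F a lam q (toX F a' lam' q p')); apply: N0.
  by rewrite /f ofXK toXK.
split; first by move=> k u v; rewrite /f !linearP.
split=> [p /EN //|p|p|p|]; apply: N0; apply: inj.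
- by rewrite toXf !toX_opA toXf.
- by rewrite toXf !toX_opB toXf EB.
- by rewrite toXf !toX_opC toXf /opCX !EB; case: Einv => _ _ ->.
- by rewrite toXf !toX1.
Qed.

Lemma size_newton : size (newton F a' lam' q n) = n.+1.
Proof.
rewrite /newton -(big_mkord xpredT (fun j => 'X - (theta a' lam' q j)%:P)).
by rewrite size_prod_XsubC size_iota subn0.
Qed.

Lemma dvd_modulus_eq0 r : P' %| r -> (size r <= n)%N -> r = 0.
Proof.
have szP : size P' = n.+1.
  rewrite /P' size_polyDl size_newton // size_polyN.
  by rewrite (leq_ltn_trans (size_polyC_leq1 _)) // ltnS ltnW.
by case: (eqVneq r 0) => // r0 /dvdp_leq; rewrite r0 szP ltnNge => /(_ isT)/negbTE->.
Qed.

Lemma dvd_modulus_const k : P' %| k%:P -> k = 0.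
Proof.
move/dvd_modulus_eq0; rewrite (leq_trans (size_polyC_leq1 _)) ?(ltnW n_gt1) //.
by move=> /(_ isT)/eqP; rewrite polyC_eq0 => /eqP.
Qed.

Lemma dvd_modulus_linear k m : P' %| k *: 'X + m%:P -> k = 0 /\ m = 0.
Proof.
move/dvd_modulus_eq0 => E.
have {}E : k *: 'X + m%:P = 0.
  apply: E; apply: leq_trans n_gt1; apply: leq_trans (size_polyD _ _) _.
  rewrite geq_max (leq_trans (size_polyC_leq1 _)) // andbT.
  by rewrite (leq_trans (size_scale_leq _ _)) // size_polyX.
split; [have /(congr1 (coefp 1)) := E|have /(congr1 (coefp 0)) := E].
  by rewrite /= coefD coefZ coefX coefC mulr1 addr0 coef0.
by rewrite /= coefD coefZ coefX coefC mulr0 add0r coef0.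
Qed.

Lemma inN_dvd p : inN n delta' p <-> P' %| toX F a' lam' q p.
Proof.
rewrite (inN_toX F q n prim_q2 a' lam'); split=> [[s ->]|/dvdpP[s ->]].
  exact: dvdp_mulr.
by exists s; rewrite mulrC.
Qed.

Lemma dvd_opBX u : P' %| u -> P' %| opBX F a' b' c' lam' q u.
Proof.
rewrite -{1}(ofXK F a' lam' q u) -inN_dvd.
move/(inN_opB F q n q0 prim_q2 a' b' c' lam' a'0 b'0 c'0 l'0).
by rewrite inN_dvd.
Qed.

Lemma dvd_opCX u : P' %| u -> P' %| opCX F a' b' c' lam' q u.
Proof.
move=> Pu; rewrite /opCX -!mul_polyC; apply: dvdp_sub; first exact: dvdp_mull.
apply: dvdp_mull; apply: dvdp_sub; apply: dvdp_mull; first exact/dvdp_mull/dvd_opBX.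
exact/dvd_opBX/dvdp_mull.
Qed.

Lemma q2_neq0 : q ^+ 2 - q ^- 2 != 0.
Proof.
apply: contra_neq q4 => /eqP; rewrite subr_eq0 => /eqP E.
by rewrite (exprM q 2 2) expr2 {2}E divff // expf_neq0.
Qed.

Lemma invariants_of_Whom f :
  Whom q n a b c lam delta a' b' c' lam' delta' f ->
  invariants F a b c lam q = invariants F a' b' c' lam' q /\
  tau a lam delta = tau a' lam' delta'.
Proof.
case=> flin [fN fA fB fC f1].
pose g p := toX F a' lam' q (f (ofX F a lam q p)).
have gP k u v : g (k *: u + v) = k *: g u + g v by rewrite /g !linearP flin linearP.
have gX p : P' %| g ('X * p) - 'X * g p.
  by have /inN_dvd := fA (ofX F a lam q p); rewrite linearB /= toX_opA -ofX_mulX.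
have g1 : P' %| g 1 - 1.
  by have /inN_dvd := f1; rewrite linearB /= toX1 /g ofX1.
have gE p : P' %| g p - p.
  elim/poly_span_ind: p => [i|k u v IHu IHv]; last first.
    have -> : g (k *: u + v) - (k *: u + v) = k%:P * (g u - u) + (g v - v).
      by rewrite gP -!mul_polyC; ring.
    by rewrite dvdp_add // dvdp_mull.
  elim: i => [|i IHi]; first by rewrite expr0.
  have -> : g 'X^(i.+1) - 'X^(i.+1) = (g ('X * 'X^i) - 'X * g 'X^i) + 'X * (g 'X^i - 'X^i).
    by rewrite !exprS; ring.
  by rewrite dvdp_add ?gX // dvdp_mull.
(* N is sent into N', so P' divides [g P], hence P, hence the constant P - P'. *)
have Etau : tau a lam delta = tau a' lam' delta'.
  have gP0 : P' %| g P.
    apply/inN_dvd/fN/(inN_toX F q n prim_q2 a lam).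
    by exists 1; rewrite ofXK mulr1.
  have := dvdp_sub gP0 (gE P); rewrite opprB addrC subrK modulus_eq dvdp_addr ?dvdpp //.
  by move/dvd_modulus_const/eqP; rewrite subr_eq0 => /eqP.
split=> //.
(* [g] may be replaced by the identity modulo P' even inside B', because B' preserves the ideal of
   P'. *)
have gB p : P' %| opBX F a b c lam q p - opBX F a' b' c' lam' q p.
  have /inN_dvd := fB (ofX F a lam q p); rewrite linearB /= toX_opB -/(g p) => fBp.
  have fBp' : P' %| g (opBX F a b c lam q p) - opBX F a' b' c' lam' q (g p).
    by rewrite /g /opBX toXK.
  have -> : opBX F a b c lam q p - opBX F a' b' c' lam' q p =
      (g (opBX F a b c lam q p) - opBX F a' b' c' lam' q (g p))
      - (g (opBX F a b c lam q p) - opBX F a b c lam q p)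
      + opBX F a' b' c' lam' q (g p - p).
    by rewrite (linearB (opBX F a' b' c' lam' q)) /=; ring.
  exact: dvdp_add (dvdp_sub fBp' (gE _)) (dvd_opBX _ (gE p)).
have gC p : P' %| opCX F a b c lam q p - opCX F a' b' c' lam' q p.
  have /inN_dvd := fC (ofX F a lam q p); rewrite linearB /= toX_opC -/(g p) => fCp.
  have fCp' : P' %| g (opCX F a b c lam q p) - opCX F a' b' c' lam' q (g p).
    by rewrite /g -[X in opCX _ _ _ _ _ _ X](ofXK F a lam q) -toX_opC toXK.
  have -> : opCX F a b c lam q p - opCX F a' b' c' lam' q p =
      (g (opCX F a b c lam q p) - opCX F a' b' c' lam' q (g p))
      - (g (opCX F a b c lam q p) - opCX F a b c lam q p)
      + opCX F a' b' c' lam' q (g p - p).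
    by rewrite (linearB (opCX F a' b' c' lam' q)) /=; ring.
  exact: dvdp_add (dvdp_sub fCp' (gE _)) (dvd_opCX _ (gE p)).
have [h0 q20] : q ^+ 2 - q ^- 2 != 0 /\ q ^+ 2 != 0 by split; rewrite ?expf_neq0 // q2_neq0.
have [qm0 qp0] : q - q^-1 != 0 /\ q + q^-1 != 0.
  apply/andP; rewrite -negb_or -mulf_eq0.
  by have -> : (q - q^-1) * (q + q^-1) = q ^+ 2 - q ^- 2 by field.
set y := b / lam; set y' := b' / lam'.
have y0 : y != 0 by rewrite mulf_neq0 ?invr_eq0.
have y'0 : y' != 0 by rewrite mulf_neq0 ?invr_eq0.
have E1 : y + y^-1 = y' + y'^-1.
  have := gB 1; rewrite !opBX1 // -polyCB => /dvd_modulus_const/eqP.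
  by rewrite subr_eq0 => /eqP.
have [EX Ek] : y * q ^+ 2 + (y * q ^+ 2)^-1 = y' * q ^+ 2 + (y' * q ^+ 2)^-1
    /\ kappaM F a b c lam q = kappaM F a' b' c' lam' q.
  have := gB 'X; rewrite !opBX_X // -/y -/y' opprD addrACA -scalerBl -polyCB.
  move=> /dvd_modulus_linear[/eqP]; rewrite subr_eq0 => /eqP-> /eqP.
  by rewrite subr_eq0 (inj_eq (mulfI qm0)) => /eqP.
(* The sum z + z^-1 fixes z only up to inversion; combined with the same sum at z q^2 it isolates z
   (q^2 - q^-2). *)
have Ey : y = y'.
  apply: (mulIf h0).
  have yE z : z != 0 -> z * (q ^+ 2 - q ^- 2)
      = z * q ^+ 2 + (z * q ^+ 2)^-1 - (z + z^-1) / q ^+ 2.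
    by move=> z0; field; rewrite q0 z0.
  by rewrite !yE // EX E1.
have EB1 : opBX F a b c lam q 1 = opBX F a' b' c' lam' q 1 by rewrite !opBX1 // -/y Ey.
have EBX : opBX F a b c lam q 'X = opBX F a' b' c' lam' q 'X.
  by rewrite !opBX_X // -/y Ey Ek.
(* As B 1 and B X already agree, the two values of C 1 differ only in their gamma terms; then those
   of B X^2 differ only in their beta terms. *)
have Eg : gammaM a b c lam q = gammaM a' b' c' lam' q.
  apply: (mulIf (x := (q + q^-1)^-1)); first by rewrite invr_eq0.
  apply/eqP; rewrite -subr_eq0; apply/eqP/dvd_modulus_const.
  have := gC 1; rewrite /opCX !mulr1 EB1 EBX -!mul_polyC polyCB.
  by apply: etrans; congr (_ %| _); ring.
have Eb : betaM F a b c lam q = betaM F a' b' c' lam' q.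
  apply: (mulfI (mulf_neq0 qm0 h0)).
  apply/eqP; rewrite -subr_eq0; apply/eqP/dvd_modulus_const.
  have := gB ('X * ('X * 1)); rewrite !opBX_mulXX // !mulr1 EB1 EBX Eg -!mul_polyC polyCB.
  by apply: etrans; congr (_ %| _); ring.
by rewrite /invariants -/y Ey Ek Eg Eb.
Qed.

End Morphisms.

(** * Permutations and the orbits of parameters *)

(** Adjacent swaps bring the head of [t] to the front of [s]; the prefix [p] in [gen] lets the
    induction continue behind it. *)
Lemma perm_eq_adjacent (T : eqType) (R : seq T -> seq T -> Prop) :
  (forall s, R s s) -> (forall s t u, R s t -> R t u -> R s u) ->
  (forall p x y s, R (p ++ [:: x, y & s]) (p ++ [:: y, x & s])) ->
  forall s t, perm_eq s t -> R s t.
Proof.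
move=> Rrefl Rtrans Rswap s t.
suff gen p : perm_eq s t -> R (p ++ s) (p ++ t) by exact: (gen [::]).
elim: t p s => [|y t IHt] p s eq_st; first by move/perm_nilP: eq_st => ->.
have /path.splitPr y_s : y \in s by rewrite (perm_mem eq_st) mem_head.
case: y_s eq_st => s1 s2; rewrite perm_catC cat_cons perm_cons perm_catC => eq_st.
apply: (Rtrans _ (p ++ y :: s1 ++ s2)).
  elim/last_ind: s1 s2 {eq_st} => [|s1 x IHs] s2 //.
  apply: (Rtrans _ (p ++ s1 ++ [:: y, x & s2])); last by rewrite cat_rcons; exact: IHs.
  by rewrite cat_rcons !catA.
by rewrite -!cat_rcons; exact: IHt.
Qed.

Section Orbits.
Variable F : closedFieldType.
Variable q : F.
Hypotheses (q0 : q != 0) (q4 : q ^+ 4 != 1).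

Lemma sqrtFK (x : F) : sqrtF x ^+ 2 = x.
Proof. exact/eqP/(xchooseP (sqrt_exists x)). Qed.

Lemma s4orbit_trans (x y z : quad F) : s4orbit q x y -> s4orbit q y z -> s4orbit q x z.
Proof. by move=> xy; elim=> // u v _ xu uv; exact: s4orbit_step uv. Qed.

Definition quad_invariants (x : quad F) :=
  let: (a, b, c, l) := x in invariants F a b c l q.

Definition nonzero_quad (x : quad F) :=
  let: (a, b, c, l) := x in [&& a != 0, b != 0, c != 0 & l != 0].

Lemma s4step_invariants x y : nonzero_quad x -> s4step q x y ->
  nonzero_quad y /\ quad_invariants y = quad_invariants x.
Proof.
case: x => [[[a b] c] l] /= /and4P[a0 b0 c0 l0].
case=> [->|[->|[->|->]]]; rewrite /= /invariants /kappaM /gammaM /betaM.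
- rewrite !oppr_eq0 a0 b0 c0 l0; split=> //.
  by congr (_, _, _, _); field; rewrite ?oppr_eq0 ?q0 ?a0 ?b0 ?c0 ?l0.
- by rewrite invr_eq0 a0 b0 c0 l0 invrK [c^-1 + c]addrC.
- set s := sqrtF _.
  have s2 : s ^+ 2 = a * b * c * l * q by exact: sqrtFK.
  have s0 : s != 0 by rewrite -sqrf_eq0 s2 !mulf_neq0.
  (* Eliminating [l] in favour of the square root [s] turns the claims into rational identities in
     free variables. *)
  have El : l = s ^+ 2 / (a * b * c * q) by rewrite s2; field; rewrite q0 a0 b0 c0.
  rewrite !mulf_neq0 ?invr_eq0 //; split=> //.
  by rewrite El; congr (_, _, _, _); field; rewrite ?q0 ?a0 ?b0 ?c0 ?s0.
- by rewrite invr_eq0 a0 b0 c0 l0 invrK [a^-1 + a]addrC.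
Qed.

Lemma s4orbit_invariants x y : nonzero_quad x -> s4orbit q x y ->
  quad_invariants y = quad_invariants x.
Proof.
move=> x0 xy; suff [] : nonzero_quad y /\ quad_invariants y = quad_invariants x by [].
by elim: xy => // u v _ [u0 <-]; exact: s4step_invariants.
Qed.

(* Up to a common sign of [r], a quadruple is given by [w = lam q r] and by the four numbers
   [c r, r / c, a / r, 1 / (a r)] of product [1], where [r ^ 2 = 1 / (b lam q)]; the group
   then permutes the four numbers. *)
Definition quad_of (w r : F) (s : seq F) : quad F :=
  (s`_2 * r, (w * r)^-1, s`_0 / r, w / (q * r)).

Section Chart.
Variable w : F.
Hypothesis w0 : w != 0.

Let chart (s : seq F) := size s = 4%N /\ \prod_(x <- s) x = 1.

(** The square determines r up to sign, and replacing r by -r is the action of -1. *)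
Lemma quad_of_sign r r' s t : r ^+ 2 = r' ^+ 2 -> s4orbit q t (quad_of w r s) ->
  s4orbit q t (quad_of w r' s).
Proof.
move/eqP; rewrite eqf_sqr => /orP[]/eqP-> // orb; apply: s4orbit_step orb _.
by left; rewrite /quad_of /qneg !(mulrN, invrN, opprK).
Qed.

(** Adjacent swaps suffice, and they are realized by [s12], [s23] and [s34]. Quantifying over all
    square roots r and r' allows any choice at an intermediate sequence. *)
Lemma quad_of_perm s t : perm_eq s t -> chart s -> forall r r',
  r ^+ 2 = s`_0 * s`_1 -> r' ^+ 2 = t`_0 * t`_1 ->
  s4orbit q (quad_of w r s) (quad_of w r' t).
Proof.
(* Carrying [perm_eq] along transfers [chart] to the middle sequence in the transitivity step. *)
move=> eq_st; suff: perm_eq s t /\ (chart s -> forall r r',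
  r ^+ 2 = s`_0 * s`_1 -> r' ^+ 2 = t`_0 * t`_1 ->
  s4orbit q (quad_of w r s) (quad_of w r' t)) by case.
move: s t eq_st; apply: perm_eq_adjacent => [s|s t u [st IHs] [tu IHt]|p x y s].
- by split=> // _ r r' <- /esym Er; apply: quad_of_sign Er _; exact: s4orbit_refl.
- split; first exact: perm_trans st tu.
  move=> [ss ps] r r' Er Er'; pose r'' := sqrtF (t`_0 * t`_1).
  apply: (s4orbit_trans _ (quad_of w r'' t)); first by apply: IHs => //; exact: sqrtFK.
  by apply: IHt => //; [rewrite /chart -(perm_size st) -(perm_big _ st)|exact: sqrtFK].
split; first by rewrite perm_cat2l; exact/permEl/(perm_catCA [:: x] [:: y]).
case: p => [|x1 [|x2 [|x3 p]]].
(* Swapping the first two numbers inverts c = x / r, because x y = r^2. *)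
- case: s => [|x3 [|x4 [|? ?]]] [] //= _ p1 r r' Er Er'.
  move: p1; rewrite /= !big_cons big_nil mulr1 => p1.
  have /and4P[x0 y0 _ _] : [&& x != 0, y != 0, x3 != 0 & x4 != 0].
    by rewrite -!negb_or -!mulf_eq0 p1 oner_eq0.
  have r0 : r != 0 by rewrite -sqrf_eq0 Er mulf_neq0.
  apply: (quad_of_sign r); first by rewrite Er Er' mulrC.
  apply: s4orbit_step (s4orbit_refl _ _) _; right; left.
  have Ey : y = r ^+ 2 / x by rewrite Er; field.
  by rewrite /quad_of /= Ey; congr (_, _, _, _); field; rewrite r0 x0.
(* Swapping the middle two replaces r by s r up to sign, where x1 y / r^2 is the quantity whose root
   [s23] takes. *)
- case: s => [|x4 [|? ?]] [] //= _ p1 r r' Er Er'.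
  move: p1; rewrite /= !big_cons big_nil mulr1 => p1.
  have /and4P[x10 x0 y0 x40] : [&& x1 != 0, x != 0, y != 0 & x4 != 0].
    by rewrite -!negb_or -!mulf_eq0 p1 oner_eq0.
  have r0 : r != 0 by rewrite -sqrf_eq0 Er mulf_neq0.
  pose s := sqrtF (x1 * y / r ^+ 2).
  have s2 : s ^+ 2 = x1 * y / r ^+ 2 by exact: sqrtFK.
  have s0 : s != 0 by rewrite -sqrf_eq0 s2 !mulf_neq0 ?invr_eq0 ?expf_neq0.
  apply: (quad_of_sign (s * r)); first by rewrite Er' exprMn s2 divfK ?expf_neq0.
  apply: s4orbit_step (s4orbit_refl _ _) _; right; right; left.
  rewrite /quad_of /s23 /=.
  have -> : y * r * (w * r)^-1 * (x1 / r) * (w / (q * r)) * q = x1 * y / r ^+ 2.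
    by field; rewrite q0 w0 r0.
  rewrite -/s; have Ex : x = r ^+ 2 / x1 by rewrite Er; field.
  have Ey : y = s ^+ 2 * r ^+ 2 / x1 by rewrite s2; field; rewrite r0 x10.
  by rewrite Ey Ex; congr (_, _, _, _); field; rewrite ?r0 ?q0 ?w0 ?s0 ?x10.
(* Swapping the last two inverts a = x r, since r^2 x y is the product of all four numbers. *)
- case: s => [|? ?] [] //= _ p1 r r' Er Er'.
  move: p1; rewrite /= !big_cons big_nil mulr1 => p1.
  have /and4P[x10 x20 x0 y0] : [&& x1 != 0, x2 != 0, x != 0 & y != 0].
    by rewrite -!negb_or -!mulf_eq0 p1 oner_eq0.
  have r0 : r != 0 by rewrite -sqrf_eq0 Er mulf_neq0.
  apply: (quad_of_sign r); first by rewrite Er Er'.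
  apply: s4orbit_step (s4orbit_refl _ _) _; right; right; right.
  rewrite /quad_of /s34 /=; congr (_, _, _, _).
  apply: (mulIf (mulf_neq0 x0 r0)); rewrite mulVf ?mulf_neq0 //.
  by transitivity (r ^+ 2 * (x * y)); [ring|rewrite Er -mulrA p1].
(* A longer prefix exceeds the length four. *)
- by case=> /= /eqP; rewrite size_cat /= !addnS !eqSS.
Qed.

End Chart.

(** Equal elementary symmetric functions give equal monic quartics, hence the same roots with
    multiplicity. *)
Lemma perm_eq_quartic (x1 x2 x3 x4 y1 y2 y3 y4 : F) :
  x1 + x2 + x3 + x4 = y1 + y2 + y3 + y4 ->
  x1 * x2 + x1 * x3 + x1 * x4 + x2 * x3 + x2 * x4 + x3 * x4
    = y1 * y2 + y1 * y3 + y1 * y4 + y2 * y3 + y2 * y4 + y3 * y4 ->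
  x1 * x2 * x3 + x1 * x2 * x4 + x1 * x3 * x4 + x2 * x3 * x4
    = y1 * y2 * y3 + y1 * y2 * y4 + y1 * y3 * y4 + y2 * y3 * y4 ->
  x1 * x2 * x3 * x4 = y1 * y2 * y3 * y4 ->
  perm_eq [:: x1; x2; x3; x4] [:: y1; y2; y3; y4].
Proof.
move=> E1 E2 E3 E4; apply: prod_XsubC_eq; rewrite !big_cons !big_nil.
have expand (z1 z2 z3 z4 : F) :
  ('X - z1%:P) * (('X - z2%:P) * (('X - z3%:P) * (('X - z4%:P) * 1)))
  = 'X ^+ 4 - (z1 + z2 + z3 + z4)%:P * 'X ^+ 3
    + (z1 * z2 + z1 * z3 + z1 * z4 + z2 * z3 + z2 * z4 + z3 * z4)%:P * 'X ^+ 2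
    - (z1 * z2 * z3 + z1 * z2 * z4 + z1 * z3 * z4 + z2 * z3 * z4)%:P * 'X
    + (z1 * z2 * z3 * z4)%:P by rewrite !(polyCD, polyCM); ring.
by rewrite !expand E1 E2 E3 E4.
Qed.

(** Both quadruples are written as [quad_of] with a common w; it remains to compare the elementary
    symmetric functions of the two sequences. *)
Lemma s4orbit_of_invariants a b c lam a' b' c' lam' :
  nonzero_quad (a, b, c, lam) -> nonzero_quad (a', b', c', lam') ->
  invariants F a b c lam q = invariants F a' b' c' lam' q ->
  s4orbit q (a, b, c, lam) (a', b', c', lam').
Proof.
move=> /and4P[a0 b0 c0 l0] /and4P[a'0 b'0 c'0 l'0] [Ey Ek Eg Eb].
pose r := sqrtF (b * lam * q)^-1; pose w := lam * q * r.
have r2 : r ^+ 2 = (b * lam * q)^-1 by exact: sqrtFK.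
have r0 : r != 0 by rewrite -sqrf_eq0 r2 invr_eq0 !mulf_neq0.
have w0 : w != 0 by rewrite !mulf_neq0.
(* Chosen to make w common; the equality of b / lam and b' / lam' gives it the right square. *)
pose r' := lam * r / lam'.
have r'0 : r' != 0 by rewrite !mulf_neq0 ?invr_eq0.
have Ew : w = lam' * q * r' by rewrite /w /r'; field.
have r'2 : r' ^+ 2 = (b' * lam' * q)^-1.
  have -> : b' = b / lam * lam' by rewrite Ey divfK.
  by rewrite /r' !exprMn r2; field; rewrite q0 l'0 l0 b0.
clearbody r'.
pose xs (a c r : F) := [:: c * r; r / c; a / r; (a * r)^-1].
have quadE (a1 b1 c1 l1 r1 : F) : a1 != 0 -> b1 != 0 -> c1 != 0 -> l1 != 0 -> r1 != 0 ->
    r1 ^+ 2 = (b1 * l1 * q)^-1 -> w = l1 * q * r1 ->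
    (a1, b1, c1, l1) = quad_of w r1 (xs a1 c1 r1).
  move=> a10 b10 c10 l10 r10 r12 ->; rewrite /quad_of /=.
  have Eb1 : b1 = (r1 ^+ 2 * l1 * q)^-1 by rewrite r12; field; rewrite b10 l10 q0 ?oner_eq0.
  by rewrite Eb1; congr (_, _, _, _); field; rewrite ?q0 ?l10 ?r10.
rewrite (quadE a b c lam r) // (quadE a' b' c' lam' r') //.
have qp0 : q + q^-1 != 0.
  apply: contra_neq q4 => E; have: q ^+ 4 - 1 = (q + q^-1) * (q * (q ^+ 2 - 1)) by field.
  by rewrite E mul0r => /eqP; rewrite subr_eq0 => /eqP.
have qq0 : q ^+ 2 + 1 != 0.
  have -> : q ^+ 2 + 1 = (q + q^-1) * q by field.
  by rewrite mulf_neq0.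
(* The first and third symmetric functions are combinations of gamma and kappa, and the second is
   beta up to terms in w. *)
have gE (a1 b1 c1 l1 r1 : F) : a1 != 0 -> b1 != 0 -> c1 != 0 -> l1 != 0 -> r1 != 0 ->
    r1 ^+ 2 = (b1 * l1 * q)^-1 -> w = l1 * q * r1 ->
  [/\ c1 * r1 + r1 / c1 + a1 / r1 + (a1 * r1)^-1 =
       w * (gammaM a1 b1 c1 l1 q / q - kappaM F a1 b1 c1 l1 q) / (q + q^-1),
     (c1 + c1^-1) / r1 + r1 * (a1 + a1^-1) =
       (gammaM a1 b1 c1 l1 q * q + kappaM F a1 b1 c1 l1 q) / (w * (q + q^-1))
   & r1 ^+ 2 + r1 ^- 2 + (c1 + c1^-1) * (a1 + a1^-1) =
       betaM F a1 b1 c1 l1 q - w ^+ 2 - w ^- 2].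
  move=> a10 b10 c10 l10 r10 r12 Ew1.
  have Eb1 : b1 = (r1 * w)^-1.
    have -> : r1 * w = r1 ^+ 2 * l1 * q by rewrite Ew1; ring.
    by rewrite r12; field; rewrite b10 l10 q0 ?oner_eq0.
  have El1 : l1 = w / (q * r1) by rewrite Ew1; field; rewrite q0 r10.
  rewrite /gammaM /kappaM /betaM Eb1 El1.
  by split; field; rewrite ?q0 ?a10 ?c10 ?r10 ?w0 ?qq0 ?oner_eq0.
have [] := gE a b c lam r a0 b0 c0 l0 r0 r2 erefl.
have [] := gE a' b' c' lam' r' a'0 b'0 c'0 l'0 r'0 r'2 Ew.
rewrite Ek Eg Eb => <- <- <- E1 E3 E2.
have prod1 (a1 c1 r1 : F) : a1 != 0 -> c1 != 0 -> r1 != 0 ->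
    c1 * r1 * (r1 / c1) * (a1 / r1) * (a1 * r1)^-1 = 1.
  by move=> a10 c10 r10; field; rewrite a10 c10 r10.
have e2 (a1 c1 r1 : F) : a1 != 0 -> c1 != 0 -> r1 != 0 ->
    c1 * r1 * (r1 / c1) + c1 * r1 * (a1 / r1) + c1 * r1 * (a1 * r1)^-1
      + r1 / c1 * (a1 / r1) + r1 / c1 * (a1 * r1)^-1 + a1 / r1 * (a1 * r1)^-1
    = r1 ^+ 2 + r1 ^- 2 + (c1 + c1^-1) * (a1 + a1^-1).
  by move=> a10 c10 r10; field; rewrite a10 c10 r10.
have e3 (a1 c1 r1 : F) : a1 != 0 -> c1 != 0 -> r1 != 0 ->
    c1 * r1 * (r1 / c1) * (a1 / r1) + c1 * r1 * (r1 / c1) * (a1 * r1)^-1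
      + c1 * r1 * (a1 / r1) * (a1 * r1)^-1 + r1 / c1 * (a1 / r1) * (a1 * r1)^-1
    = (c1 + c1^-1) / r1 + r1 * (a1 + a1^-1).
  by move=> a10 c10 r10; field; rewrite a10 c10 r10.
apply: quad_of_perm => //.
- by apply: perm_eq_quartic; rewrite ?e2 ?e3 ?prod1.
- by split=> //; rewrite !big_cons big_nil mulr1 -[RHS](prod1 a c r) // !mulrA.
- by rewrite /=; field; rewrite c0.
- by rewrite /=; field; rewrite c'0.
Qed.

End Orbits.

(** * Equivalence of the five conditions *)

Theorem theorem7p4 (F : closedFieldType) (q : F) (d : nat)
  (Hq : d.-primitive_root q) (Hd : d \notin [:: 1; 2; 4]%N)
  (a b c lam delta a' b' c' lam' delta' : F)
  (Ha : a != 0) (Hb : b != 0) (Hc : c != 0) (Hlam : lam != 0)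
  (Ha' : a' != 0) (Hb' : b' != 0) (Hc' : c' != 0) (Hlam' : lam' != 0) :
  [<-> equivS4 q (dprime d) a b c lam delta a' b' c' lam' delta';
       exists f, Whom q (dprime d) a b c lam delta a' b' c' lam' delta' f;
       exists f, Whom q (dprime d) a' b' c' lam' delta' a b c lam delta f;
       exists f, Wiso q (dprime d) a b c lam delta a' b' c' lam' delta' f;
       exists f, Wiso q (dprime d) a' b' c' lam' delta' a b c lam delta f].
Proof.
have q0 : q != 0.
  by rewrite (prim_root_eq0 Hq) -lt0n (prim_order_gt0 Hq).
have q4 : q ^+ 4 != 1.
  rewrite -(prim_order_dvd Hq); apply: contra Hd => d4.
  by have := @dvdn_leq d 4 isT d4; case: (d) d4 => [|[|[|[|[|]]]]].
set n := dprime d.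
(* The order of q^2 is d / gcd(2, d), which is d'. *)
have prim_q2 : n.-primitive_root (q ^+ 2).
  have := exp_prim_root Hq 2; congr (_.-primitive_root _); rewrite /n /dprime.
  case: ifPn => [odd_d|even_d].
    by rewrite (_ : gcdn 2 d = 1%N) ?divn1 //; apply/eqP; rewrite -[_ == _]/(coprime 2 d) coprime2n.
  by rewrite (gcdn_idPl _) ?dvdn2 // divn2.
have n_gt1 : (1 < n)%N.
  rewrite ltn_neqAle (prim_order_gt0 prim_q2) andbT; apply: contra q4 => /eqP n1.
  rewrite (exprM q 2 2); move: (prim_expr_order prim_q2); rewrite -n1 expr1 => ->.
  by rewrite expr1n.
(* [J] is symmetric in the two parameter families; in either direction a homomorphism implies it and
   it yields an isomorphism. *)
pose J := invariants F a b c lam q = invariants F a' b' c' lam' q /\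
  delta + a ^+ n * lam ^- n + a ^- n * lam ^+ n
  = delta' + a' ^+ n * lam' ^- n + a' ^- n * lam' ^+ n.
have x0 : nonzero_quad F (a, b, c, lam) by rewrite /= Ha Hb Hc.
have x'0 : nonzero_quad F (a', b', c', lam') by rewrite /= Ha' Hb' Hc'.
have equivJ : equivS4 q n a b c lam delta a' b' c' lam' delta' <-> J.
  split=> -[E Etau]; split=> //; first exact/esym/(s4orbit_invariants F q q0 _ _ x0 E).
  exact: s4orbit_of_invariants.
have JWhom f : Whom q n a b c lam delta a' b' c' lam' delta' f -> J.
  exact: invariants_of_Whom.
have JWhom' f : Whom q n a' b' c' lam' delta' a b c lam delta f -> J.
  by move=> Wf; have [] := invariants_of_Whom _ _ _ _ _ _ _ _ _ _ _ _ _ q0 q4 n_gt1 prim_q2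
    Ha' Hb' Hc' Hlam' Ha Hb Hc Hlam f Wf.
have JWiso : J -> exists f, Wiso q n a b c lam delta a' b' c' lam' delta' f.
  by case; exact: Wiso_of_invariants.
have JWiso' : J -> exists f, Wiso q n a' b' c' lam' delta' a b c lam delta f.
  by case=> /esym E /esym Et; exact: Wiso_of_invariants.
tfae.
- by move/equivJ/JWiso=> [f [Wf _ _]]; exists f.
- by case=> f /JWhom/JWiso'[g [Wg _ _]]; exists g.
- by case=> f /JWhom'/JWiso.
- by case=> f [/JWhom/JWiso'].
- by case=> f [/JWhom' Jf _ _]; exact/equivJ.
Qed.
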